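(* Let $n\ge 3$. Every family of at least $\left(\binom{2n-5}{n-2}+1\right)\binom{2n-4}{n-2}+1$ pairwise disjoint convex bodies in the plane that is in general position, in which no two members are tangent and no three members share a common tangent line, contains $n$ members in convex position. That is, $M(n)\le \left(\binom{2n-5}{n-2}+1\right)\binom{2n-4}{n-2}+1$.
   Context: A convex body is a compact convex set in the plane. A family $\mathcal{F}$ is in convex position if for every $A\in\mathcal{F}$, $\mathrm{conv}(\bigcup\mathcal{F})\neq \mathrm{conv}(\bigcup(\mathcal{F}\setminus\{A\}))$; it is in general position if every 3-element subfamily is in convex position. $M(n)$ denotes the least integer such that every such family of pairwise disjoint convex bodies with at least $M(n)$ members contains $n$ members in convex position. *)

(* Defs.v *)
From HB Require Import structures.
From mathcomp Require Import all_boot all_order all_algebra.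
From mathcomp Require Import all_classical all_reals all_analysis.

Set Implicit Arguments.
Unset Strict Implicit.
Unset Printing Implicit Defensive.

Import Order.TTheory GRing.Theory Num.Theory.
Import numFieldNormedType.Exports.

Local Open Scope classical_set_scope.
Local Open Scope card_scope.
Local Open Scope ring_scope.

Notation plane R := 'rV[R]_2.

Definition dotp (R : realType) (u x : plane R) : R :=
  \sum_(i < 2) u ord0 i * x ord0 i.

Definition convex_body (R : realType) (A : set (plane R)) : Prop :=
  compact A /\ convex_set A.

Definition conv_hull (R : realType) (A : set (plane R)) : set (plane R) :=
  smallest (@convex_set R (plane R)) A.

(* As the members of the families considered are pairwise disjoint and, by
   general position, nonempty, a family is taken to be a set of sets. *)
Definition convex_position (R : realType) (F : set (set (plane R))) : Prop :=
  forall A, F A ->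
    conv_hull (\bigcup_(B in F) B) <> conv_hull (\bigcup_(B in F `\ A) B).

Definition general_position (R : realType) (F : set (set (plane R))) : Prop :=
  forall G, G `<=` F -> G #= `I_3 -> convex_position G.

Definition pairwise_disjoint (R : realType) (F : set (set (plane R))) : Prop :=
  forall A B, F A -> F B -> A <> B -> A `&` B = set0.

(* L is a supporting line of A. Having A on the side <= c is no restriction,
   since (u, c) and (- u, - c) define the same line. *)
Definition tangent_line (R : realType) (L A : set (plane R)) : Prop :=
  exists (u : plane R) (c : R),
    [/\ u != 0, L = [set x | dotp u x = c],
        A `<=` [set x | dotp u x <= c] & A `&` L !=set0].

(* A and B touch at p; both external and internal contacts count. *)
Definition tangent_bodies (R : realType) (A B : set (plane R)) : Prop :=
  exists (L : set (plane R)) (p : plane R),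
    [/\ tangent_line L A, tangent_line L B & (A `&` B `&` L) p].

Definition no_two_tangent (R : realType) (F : set (set (plane R))) : Prop :=
  forall A B, F A -> F B -> A <> B -> ~ tangent_bodies A B.

Definition no_three_common_tangent (R : realType)
    (F : set (set (plane R))) : Prop :=
  forall A B C, F A -> F B -> F C -> A <> B -> A <> C -> B <> C ->
    ~ exists L, [/\ tangent_line L A, tangent_line L B & tangent_line L C].

Record admissible (R : realType) (F : set (set (plane R))) : Prop := Admissible {
  adm_body : forall A, F A -> convex_body A;
  adm_disjoint : pairwise_disjoint F;
  adm_general : general_position F;
  adm_no_two : no_two_tangent F;
  adm_no_three : no_three_common_tangent F
}.

Definition contains_convex_position (R : realType) (n : nat)
    (F : set (set (plane R))) : Prop :=
  exists G, [/\ G `<=` F, G #= `I_n & convex_position G].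

Definition forces_convex_position (R : realType) (n m : nat) : Prop :=
  forall F : set (set (plane R)),
    admissible F -> `I_m #<= F -> contains_convex_position n F.

(* m = M(n). *)
Definition is_M (R : realType) (n m : nat) : Prop :=
  forces_convex_position R n m /\
  forall k, forces_convex_position R n k -> (m <= k)%N.

(* Main.v *)
(* For a convex body A let f_A(t) be its support function in the direction
   (cos t, sin t).  Disjointness says that two of these periodic curves cross
   exactly twice per period, the absence of common tangents that no three of them
   meet, and a family is in convex position iff each of its curves is somewhere
   strictly above all the others.

   Let A be the body with the highest curve at t = 0.  Every other curve j is
   above A exactly on an interval J_j of (0, 2 pi).  Partially order the bodies by
   nesting of the J_j: there is a chain of more than C(2n-4, n-2) bodies or an
   antichain of more than C(2n-5, n-2).  In both cases an Erdos-Szekeres argument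
   on two-coloured triples applies.
   - In a chain, curve j is above the outer curve i on an interval (l_ij, r_ij); a
     triple i, j, k is red if l_ij < l_jk, and then j is visible to the left of k.
     Otherwise it is visible to the right of k.  Red cliques and blue cliques are
     both in convex position.
   - In an antichain, i and j cross once above A at x_ij, and once on the other
     side at y_ij.  A triple is red if x_ij < x_jk; red cliques are in convex
     position together with A, so that n - 1 bodies suffice.  Otherwise
     y_jk < y_ij, and blue cliques are in convex position. *)
Require Import Defs.
From mathcomp Require Import all_boot all_order all_algebra.
From mathcomp Require Import all_classical all_reals all_analysis.
From mathcomp Require Import zify ring lra.

Set Implicit Arguments.
Unset Strict Implicit.
Unset Printing Implicit Defensive.

Import Order.TTheory GRing.Theory Num.Theory.
Import numFieldNormedType.Exports.

(** * Chains, antichains and cliques of triples *)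

(** The minimal elements [M] of [D] form an antichain. If it is small, enough elements remain
    without it for the induction, and the chain found there extends below its head, which is not
    minimal. *)
Lemma mirsky (T : finType) (e : rel T) (a b : nat) (D : {set T}) :
    irreflexive e -> transitive e -> a * b < #|D| ->
  (exists s : seq T, [/\ size s = a.+1, sorted e s & {subset s <= D}]) \/
  (exists S : {set T}, [/\ S \subset D, b < #|S| &
     {in S &, forall x y, ~~ e x y}]).
Proof.
move=> eI eT; elim: a D => [|a IHa] D ltD.
  have /card_gt0P[x xD] : 0 < #|D| by lia.
  by left; exists [:: x]; split=> // y; rewrite inE => /eqP->.
pose M := [set x in D | [forall y in D, ~~ e y x]].
have MD : M \subset D by apply/fintype.subsetP => x; rewrite inE => /andP[].
have [bM|Mb] := ltnP b #|M|.
  right; exists M; split=> // x y /(fintype.subsetP MD) xD.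
  by rewrite inE => /andP[_ /forall_inP/(_ x xD)].
have ltDM : a * b < #|D :\: M|.
  have := cardsID M D; rewrite (finset.setIidPr MD); lia.
have [[s [szs sS sD]]|[S [SD bS SA]]] := IHa _ ltDM; last first.
  by right; exists S; split=> //; apply: fintype.subset_trans SD (finset.subsetDl _ _).
case: s szs sS sD => // x s [szs] xs xsD; left.
have : x \in D :\: M by apply: xsD; rewrite mem_head.
rewrite !inE => /andP[+ xD]; rewrite xD /= negb_forall_in.
move=> /exists_inP[y yD /negPn yx].
exists [:: y, x & s]; split=> /=; rewrite ?szs ?yx // => z.
rewrite inE => /predU1P[->//|/xsD]; by rewrite inE => /andP[].
Qed.

Definition triple_clique (T : eqType) (lt : rel T) (P : T -> T -> T -> Prop)
    (s : seq T) : Prop :=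
  {in s & &, forall i j k, lt i j -> lt j k -> P i j k}.

(** * Erdos-Szekeres for triples coloured red and blue *)

Section ErdosSzekeres.
Variables (T : finType) (lt : rel T) (red : T -> T -> T -> Prop).
Variable D0 : {set T}.
Hypothesis ltI : irreflexive lt.
Hypothesis ltT : transitive lt.
Hypothesis lt_total : {in D0 &, forall x y, x != y -> lt x y || lt y x}.
Hypothesis redE : forall i j k m,
  i \in D0 -> j \in D0 -> k \in D0 -> m \in D0 -> lt i j -> lt j k -> lt k m ->
  [/\ (red i j k -> red j k m -> red i j m),
      (~ red i j k -> ~ red j k m -> ~ red i j m) &
      (~ red i j k -> ~ red j k m -> ~ red i k m)].

Let blue i j k := ~ red i j k.
Let gt x y := lt y x.

Let gtT : transitive gt.
Proof. by move=> y x z yx zy; apply: ltT zy yx. Qed.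

Let lt_asym x y : lt x y -> lt y x -> False.
Proof. by move=> xy yx; have := ltT xy yx; rewrite ltI. Qed.

Let pair_clique P (x y : T) : lt x y -> triple_clique lt P [:: x; y].
Proof.
move=> xy i j k; rewrite !inE.
by do 3![case/orP=> /eqP->] => //; rewrite ?ltI // => ? /lt_asym; case.
Qed.

(** Triples [i j q] with [i], [j] in [s] are red by the first law of [redE]: [i j p] belongs to the
    old clique and [j p q] is red by assumption. *)
Let red_extend p q s : {subset [:: q, p & s] <= D0} ->
  sorted gt [:: q, p & s] -> triple_clique lt red (p :: s) ->
  {in s, forall a, red a p q} -> triple_clique lt red [:: q, p & s].
Proof.
move=> sD; rewrite (sorted_pairwise gtT) => /andP[/allP qps].
rewrite -/(pairwise _ (p :: s)) => /andP[/allP ps _] cl rq.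
have inD x : x \in p :: s -> x \in D0 by move=> xs; apply: sD; rewrite inE xs orbT.
have qD : q \in D0 by apply: sD; rewrite mem_head.
move=> i j k; rewrite inE => iqs jqs kqs ij jk.
have [jq|jq] := eqVneq j q.
  move: kqs; rewrite inE => /predU1P[kq|/qps kq]; first by move: jk; rewrite jq kq ltI.
  by case: (lt_asym jk); rewrite jq.
have {}jqs : j \in p :: s by move: jqs; rewrite inE (negPf jq).
have {}iqs : i \in p :: s.
  by case/predU1P: iqs => // iq; case: (lt_asym ij); rewrite iq; apply: qps.
move: kqs; rewrite inE => /predU1P[kq|kqs]; last exact: cl.
move: jqs iqs; rewrite kq inE => /predU1P[jp|js].
  rewrite inE => /predU1P[ip|/rq]; last by rewrite jp.
  by move: ij; rewrite ip jp ltI.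
move=> iqs.
have jp : lt j p := ps _ js.
have pq : lt p q by apply: qps; rewrite mem_head.
have jps : j \in p :: s by rewrite inE js orbT.
have pD : p \in D0 by apply: inD; rewrite mem_head.
have [+ _ _] := redE (inD i iqs) (inD j jps) pD qD ij jp pq.
apply; last exact: rq.
by apply: cl; rewrite ?mem_head.
Qed.

(** One blue triple suffices: the second law of [redE] spreads [a p q] to all [a p k], and the third
    turns [a p j] and [p j k] into [a j k]. *)
Let blue_extend a p q s : {subset [:: a, p, q & s] <= D0} ->
  sorted lt [:: a, p, q & s] -> triple_clique lt blue [:: p, q & s] ->
  blue a p q -> triple_clique lt blue [:: a, p, q & s].
Proof.
move=> sD; rewrite (sorted_pairwise ltT) => /andP[/allP aps].
rewrite -/(pairwise _ [:: p, q & s]) => /andP[/allP pqs].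
rewrite -/(pairwise _ (q :: s)) => /andP[/allP qs _] cl apq.
have inD x : x \in [:: p, q & s] -> x \in D0.
  by move=> xs; apply: sD; rewrite inE xs orbT.
have aD : a \in D0 by apply: sD; rewrite mem_head.
have pps : p \in [:: p, q & s] by rewrite mem_head.
have qps : q \in [:: p, q & s] by rewrite !inE eqxx orbT.
have apk k : k \in q :: s -> blue a p k.
  rewrite inE => /predU1P[->//|ks].
  have kps : k \in [:: p, q & s] by rewrite !inE ks !orbT.
  have pq : lt p q by apply: pqs; rewrite mem_head.
  have qk := qs _ ks.
  have [_ + _] := redE aD (inD p pps) (inD q qps) (inD k kps) (aps _ pps) pq qk.
  by apply=> //; apply: cl.
move=> i j k iaps japs kaps ij jk.
have [ka|ka] := eqVneq k a.
  by move: japs; rewrite inE => /predU1P[ja|/aps aj];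
    [move: jk; rewrite ja ka ltI | case: (lt_asym jk); rewrite ka].
have {}kaps : k \in [:: p, q & s] by move: kaps; rewrite inE (negPf ka).
have [ja|ja] := eqVneq j a.
  by move: iaps; rewrite inE => /predU1P[ia|/aps ai];
    [move: ij; rewrite ia ja ltI | case: (lt_asym ij); rewrite ja].
have {}japs : j \in [:: p, q & s] by move: japs; rewrite inE (negPf ja).
move: iaps; rewrite inE => /predU1P[ia|ia]; last exact: cl.
rewrite ia; have [jp|jp] := eqVneq j p.
  rewrite jp; apply: apk; move: kaps; rewrite inE => /predU1P[kp|//].
  by move: jk; rewrite kp jp ltI.
have jqs : j \in q :: s by move: japs; rewrite inE (negPf jp).
have pj := pqs _ jqs.
have [_ _ +] := redE aD (inD p pps) (inD j japs) (inD k kaps) (aps _ pps) pj jk.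
apply; first exact: apk.
exact: cl.
Qed.

(* Here a red clique is listed downwards and a blue one upwards, so that the
   two meet head to head: either the red one grows by the second element of the
   blue one, or the blue one by some element of the red one. *)
Let cups_caps i j (D : {set T}) : D \subset D0 -> 'C(i + j, i) < #|D| ->
  (exists s, [/\ size s = i.+2, sorted gt s, {subset s <= D} &
     triple_clique lt red s]) \/
  (exists s, [/\ size s = j.+2, sorted lt s, {subset s <= D} &
     triple_clique lt blue s]).
Proof.
have two (E : {set T}) : E \subset D0 -> 1 < #|E| ->
    exists x y, [/\ x \in E, y \in E & lt x y].
  move=> ED /card_gt1P[x [y [xE yE xy]]].
  by have /orP[] := lt_total (fintype.subsetP ED _ xE) (fintype.subsetP ED _ yE) xy;
    [exists x, y | exists y, x].
elim: i j D => [|i IHi] j D DD0.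
  rewrite bin0 => /(two _ DD0)[x [y [xD yD xy]]]; left; exists [:: y; x].
  split=> //=; first by rewrite /gt xy.
    by move=> z; rewrite !inE => /orP[] /eqP->.
  by move=> u v w; rewrite !(inE, orbC (_ == y));
    have := @pair_clique red x y xy u v w; rewrite !inE; apply.
elim: j D DD0 => [|j IHj] D DD0.
  rewrite addn0 binn => /(two _ DD0)[x [y [xD yD xy]]]; right; exists [:: x; y].
  split=> //=; first by rewrite xy.
    by move=> z; rewrite !inE => /orP[] /eqP->.
  exact: pair_clique.
rewrite addSn binS => ltD.
(* [X] collects the heads of red cliques of size [i + 2]. Outside [X] there is no such clique, so
   the induction on [i] gives a blue one. Inside [X] the induction on [j] gives, unless a large red
   clique appears, a blue clique whose head also heads a red one. *)
pose X := [set p in D | `[< exists s, [/\ size s = i.+1, sorted gt (p :: s),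
  {subset p :: s <= D} & triple_clique lt red (p :: s)] >]].
have XD : X \subset D by apply/fintype.subsetP => x; rewrite inE => /andP[].
have [XC|ltX] := leqP #|X| 'C(i.+1 + j, i.+1).
  have : 'C(i + j.+1, i) < #|D :\: X|.
    have := cardsID X D; rewrite (finset.setIidPr XD).
    by move: ltD XC; rewrite addSnnS; lia.
  case/IHi; first exact: fintype.subset_trans (finset.subsetDl _ _) DD0.
    case=> -[|p s] [] // [szs] ps psD rps.
    have psD' : {subset p :: s <= D} by move=> x /psD; rewrite inE => /andP[].
    have : p \in D :\: X by apply: psD; rewrite mem_head.
    rewrite inE => /andP[/negP[]]; rewrite inE psD' ?mem_head //=.
    by apply/asboolP; exists s.
  case=> s [szs ss sD bs]; right; exists s; split=> //.
  by move=> x /sD; rewrite inE => /andP[].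
have [|[s [szs ss sX rs]]|] := IHj X _ ltX.
- exact: fintype.subset_trans XD DD0.
- by left; exists s; split=> // x /sX/(fintype.subsetP XD).
case=> -[|p [|q r]] [] // szr pqr sX bs.
have qD : q \in D by apply: (fintype.subsetP XD); apply: sX; rewrite !inE eqxx orbT.
have : p \in X by apply: sX; rewrite mem_head.
rewrite inE => /andP[pD /asboolP[s [szs ps psD rps]]].
have pq : lt p q by case/andP: pqr.
have [rq|/existsNP[a /not_implyP[/= sa ra]]] :=
    EM (forall a, a \in s -> red a p q).
  left; exists [:: q, p & s].
  have qpsD : {subset [:: q, p & s] <= D}.
    by move=> x; rewrite inE => /predU1P[->//|/psD].
  split=> //=; [by rewrite szs | by rewrite /gt pq|].
  apply: red_extend => //=; last by rewrite /gt pq.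
  by move=> x /qpsD/(fintype.subsetP DD0).
have ap : lt a p.
  by move: ps; rewrite (sorted_pairwise gtT) => /andP[/allP/(_ a sa)].
have apqD : {subset [:: a, p, q & r] <= D}.
  move=> x; rewrite inE => /predU1P[->|/sX/(fintype.subsetP XD)//].
  by apply: psD; rewrite inE sa orbT.
right; exists [:: a, p, q & r]; split=> //; [by rewrite -szr | by rewrite /= ap|].
apply: blue_extend => //=; last by rewrite ap.
by move=> x /apqD/(fintype.subsetP DD0).
Qed.

Lemma erdos_szekeres i j : 'C(i + j, i) < #|D0| ->
  (exists s, [/\ size s = i.+2, uniq s, {subset s <= D0} &
     triple_clique lt red s]) \/
  (exists s, [/\ size s = j.+2, uniq s, {subset s <= D0} &
     triple_clique lt (fun i j k => ~ red i j k) s]).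
Proof.
move=> /(cups_caps (fintype.subxx _))[] [s [szs ss sD cs]]; [left|right]; exists s.
- by split=> //; apply: sorted_uniq ss => // x; apply: ltI.
- by split=> //; apply: sorted_uniq ss.
Qed.

End ErdosSzekeres.

(** * Periodic curves crossing twice *)

Local Open Scope ring_scope.

(** The midpoint of the maximum of the first list and the minimum of the second; the heads [x0] and
    [y0] ensure that both exist. Visibility of a curve is reduced to such finite systems of
    bounds. *)
Lemma exists_between (R : realFieldType) (x0 y0 : R) (lo hi : seq R) :
    {in x0 :: lo & y0 :: hi, forall x y, x < y} ->
  exists t, {in x0 :: lo, forall x, x < t} /\ {in y0 :: hi, forall y, t < y}.
Proof.
move=> lohi.
have [x xlo xmax] : exists2 x, x \in x0 :: lo & {in x0 :: lo, forall z, z <= x}.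
  elim: lo {lohi} => [|a lo [x xlo xmax]].
    by exists x0; rewrite ?mem_head // => z; rewrite inE => /eqP->.
  have [ax|xa] := leP a x.
    exists x; first by move: xlo; rewrite !inE => /orP[->//|->]; rewrite !orbT.
    move=> z; rewrite !inE => /or3P[z0|/eqP->//|zlo]; apply: xmax;
      by rewrite inE ?z0 ?zlo ?orbT.
  exists a; first by rewrite !inE eqxx orbT.
  move=> z; rewrite !inE => /or3P[z0|/eqP->//|zlo]; apply: le_trans (ltW xa);
    by apply: xmax; rewrite inE ?z0 ?zlo ?orbT.
have [y yhi ymin] : exists2 y, y \in y0 :: hi & {in y0 :: hi, forall z, y <= z}.
  elim: hi {lohi} => [|a hi [y yhi ymin]].
    by exists y0; rewrite ?mem_head // => z; rewrite inE => /eqP->.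
  have [ya|ay] := leP y a.
    exists y; first by move: yhi; rewrite !inE => /orP[->//|->]; rewrite !orbT.
    move=> z; rewrite !inE => /or3P[z0|/eqP->//|zhi]; apply: ymin;
      by rewrite inE ?z0 ?zhi ?orbT.
  exists a; first by rewrite !inE eqxx orbT.
  move=> z; rewrite !inE => /or3P[z0|/eqP->//|zhi]; apply: le_trans (ltW ay) _;
    by apply: ymin; rewrite inE ?z0 ?zhi ?orbT.
have xy := lohi x y xlo yhi.
exists ((x + y) / 2); split=> z => [/xmax|/ymin]; lra.
Qed.

Section CurveSystem.
Variables (R : realType) (T : finType) (f : T -> R -> R) (P : R).
Hypothesis P_gt0 : 0 < P.
Hypothesis f_cont : forall i, continuous (f i).
Hypothesis f_per : forall i t, f i (t + P) = f i t.
Hypothesis two_cross : forall i j a b c d, i != j ->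
  a < b -> b < c -> c < d -> d < a + P ->
  f j a <= f i a -> f i b <= f j b -> f j c <= f i c -> f i d <= f j d -> False.
Hypothesis no_triple : forall i j k t, i != j -> i != k -> j != k ->
  f i t = f j t -> f i t = f k t -> False.
Hypothesis visible3 : forall i j k, i != j -> i != k -> j != k ->
  exists t, f j t < f i t /\ f k t < f i t.

(** * Crossings and bumps of two curves *)

Definition all_visible (s : seq T) : Prop :=
  {in s, forall i, exists t, {in s, forall j, j != i -> f j t < f i t}}.

(** The intermediate value theorem gives [x]. A wrong sign elsewhere would make four alternations
    with [s], [x] and [t]; the inequalities of [two_cross] are weak, so the zero [x] counts for
    either sign. *)
Lemma crossing i j s t : i != j -> s < t -> t < s + P ->
    f j s < f i s -> f i t < f j t ->
  exists x, [/\ s < x < t, f i x = f j x,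
    (forall y, s <= y -> y < x -> f j y < f i y) &
    (forall y, x < y -> y <= t -> f i y < f j y)].
Proof.
move=> ij st tsP js it.
have [||x] := @IVT R (fun y => f i y - f j y) s t 0 (ltW st).
- apply: continuous_subspaceT => y.
  by apply: cvgB; apply: f_cont.
- by rewrite ge_min le_max !subr_ge0 !subr_le0 (ltW js) (ltW it) orbT.
rewrite in_itv /= => /andP[sx xt] /subr0_eq ijx.
have {}sx : s < x.
  by rewrite lt_neqAle sx andbT; apply/eqP => E; move: js; rewrite E ijx ltxx.
have {}xt : x < t.
  by rewrite lt_neqAle xt andbT; apply/eqP => E; move: it; rewrite -E ijx ltxx.
exists x; split=> //; first by rewrite sx.
- move=> y sy yx; rewrite ltNge; apply/negP => ijy.
  have [E|sy'] := eqVneq s y; first by move: js; rewrite E ltNge ijy.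
  have {}sy : s < y by rewrite lt_neqAle sy'.
  by apply: (two_cross ij sy yx xt tsP); rewrite ?ijx // ltW.
- move=> y xy yt; rewrite ltNge; apply/negP => ijy.
  have [E|ty'] := eqVneq y t; first by move: it; rewrite -E ltNge ijy.
  have {}yt : y < t by rewrite lt_neqAle ty'.
  by apply: (two_cross ij sx xy yt tsP); rewrite ?ijx // ltW.
Qed.

(** Here [i] is the outer curve, on top at both ends of the period from 0 to [P], and [j] rises
    above it once. *)
Record bump (i j : T) (l r : R) : Prop := Bump {
  bump_l : 0 < l; bump_lr : l < r; bump_r : r < P;
  bump_eql : f i l = f j l; bump_eqr : f i r = f j r;
  bump_in : forall t, l < t -> t < r -> f i t < f j t;
  bump_before : forall t, 0 <= t -> t < l -> f j t < f i t;
  bump_after : forall t, r < t -> t <= P -> f j t < f i t }.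

Lemma bump_lt i j l r t : bump i j l r -> 0 <= t -> t <= P ->
  f i t < f j t -> l < t < r.
Proof.
move=> b t0 tP ij; apply/andP; split; rewrite ltNge; apply/negP.
  rewrite le_eqVlt => /predU1P[E|/(bump_before b t0)]; last by rewrite ltNge ltW.
  by move: ij; rewrite E (bump_eql b) ltxx.
rewrite le_eqVlt => /predU1P[E|/(bump_after b)/(_ tP)]; last by rewrite ltNge ltW.
by move: ij; rewrite -E (bump_eqr b) ltxx.
Qed.

Lemma bump_le i j l r t : bump i j l r -> l <= t <= r -> f i t <= f j t.
Proof.
move=> b /andP[]; rewrite le_eqVlt => /predU1P[<-|lt]; first by rewrite (bump_eql b).
rewrite le_eqVlt => /predU1P[->|tr]; first by rewrite (bump_eqr b).
exact/ltW/(bump_in b).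
Qed.

(** One multiple of [P] is subtracted for all curves at once, so that comparisons between curves
    survive. *)
Lemma periodic_shift c t : exists u, [/\ c <= u, u < c + P & forall i, f i u = f i t].
Proof.
have perN i (n : nat) u : f i (u + P *+ n) = f i u.
  by elim: n => [|n IH]; rewrite ?mulr0n ?addr0 // mulrSr addrA f_per.
have perz i (z : int) u : f i (u + P *~ z) = f i u.
  case: z => n; first exact: perN.
  by rewrite NegzE mulrNz -(perN i n.+1) addrNK.
exists (t - P *~ Num.floor ((t - c) / P)); split.
- have := floor_le ((t - c) / P).
  rewrite ler_pdivlMr // -mulrzl; lra.
- have := floorD1_gt ((t - c) / P).
  rewrite ltr_pdivrMr // intrD -mulrzl; lra.
- by move=> i; rewrite -mulrNz perz.
Qed.

Lemma visible3_window c i j k : i != j -> i != k -> j != k ->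
  exists t, [/\ c <= t, t < c + P, f j t < f i t & f k t < f i t].
Proof.
move=> ij ik jk; have [t [fj fk]] := visible3 ij ik jk.
by have [u [cu uc E]] := periodic_shift c t; exists u; rewrite !E.
Qed.

Lemma bump_exists i j t : i != j -> 0 < t -> t < P ->
  f j 0 < f i 0 -> f i t < f j t -> exists l r, bump i j l r.
Proof.
move=> ij t0 tP ji0 ijt; have E k : f k P = f k 0 by rewrite -[P]add0r f_per.
have [l [/andP[l0 lt] eql lo ml]] : exists x, [/\ 0 < x < t, f i x = f j x,
    (forall y, 0 <= y -> y < x -> f j y < f i y) &
    (forall y, x < y -> y <= t -> f i y < f j y)].
  by apply: crossing; rewrite ?add0r.
have [|||r [/andP[tr rP] eqr mr hi]] := @crossing j i t P _ tP _ ijt.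
- by rewrite eq_sym.
- by rewrite ltrDr.
- by rewrite !E.
exists l, r; split=> //; first exact: lt_trans tr.
move=> u lu ur; have [ut|/ltW tu] := leP u t; [exact: ml | exact: mr].
Qed.

(** Here [lt i j] makes [i] the outer curve. The intervals where [j] exceeds its outer curves have a
    common part; there [j] is visible to the left of all bumps over it in a red clique, and to the
    right of them in a blue one. *)
Lemma nested_chain (lt : rel T) (l r : T -> T -> R) (D : {set T}) m :
    irreflexive lt -> transitive lt ->
    {in D &, forall x y, x != y -> lt x y || lt y x} ->
    {in D &, forall i j, lt i j -> bump i j (l i j) (r i j)} ->
    ('C(m + m, m) < #|D|)%N ->
  exists s, [/\ size s = m.+2, uniq s & all_visible s].
Proof.
move=> ltI ltT ltD bD ltm.
have ltN i j : lt i j -> i != j by apply: contraTneq => ->; rewrite ltI.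
have lge0 i j : i \in D -> j \in D -> lt i j -> 0 <= l i j.
  by move=> iD jD ij; apply/ltW/(bump_l (bD i j iD jD ij)).
(* Somewhere [j] is above both [i] and [i'], and that point lies in both intervals. *)
have lr_meet i i' j : i \in D -> i' \in D -> j \in D -> lt i j -> lt i' j ->
    l i j < r i' j.
  move=> iD i'D jD ij i'j; have [<-|ii'] := eqVneq i i'.
    exact: bump_lr (bD _ _ iD jD ij).
  have ji : j != i by rewrite eq_sym ltN.
  have ji' : j != i' by rewrite eq_sym ltN.
  have [t [t0 tP fi fi']] := visible3_window 0 ji ji' ii'.
  rewrite add0r in tP.
  have /andP[lt1 _] := bump_lt (bD _ _ iD jD ij) t0 (ltW tP) fi.
  have /andP[_ lt2] := bump_lt (bD _ _ i'D jD i'j) t0 (ltW tP) fi'.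
  exact: lt_trans lt2.
(* Take [t] where [j] is above [i] and [k]. It lies beyond [l i j], hence beyond [l j k]; as [k] is
   below [j] there, it has reached [r j k], while still being before [r i j]. *)
have blue_r i j k : i \in D -> j \in D -> k \in D -> lt i j -> lt j k ->
    ~ l i j < l j k -> r j k < r i j.
  move=> iD jD kD ij jk /negP; rewrite -leNgt => ljk.
  have ji : j != i by rewrite eq_sym ltN.
  have [t [t0 tP fi fk]] := visible3_window 0 ji (ltN _ _ jk)
    (ltN _ _ (ltT _ _ _ ij jk)).
  rewrite add0r in tP.
  have /andP[lt1 lt2] := bump_lt (bD _ _ iD jD ij) t0 (ltW tP) fi.
  apply: le_lt_trans lt2; rewrite leNgt; apply/negP => tr.
  have := bump_in (bD _ _ jD kD jk) (le_lt_trans ljk lt1) tr.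
  by rewrite ltNge ltW.
pose red i j k := l i j < l j k.
(* Each law is proved by contradiction at one point, [l j p], [l i j] and [l i k] respectively,
   where the comparisons of the curves would close into a cycle. *)
have redE i j k p : i \in D -> j \in D -> k \in D -> p \in D ->
    lt i j -> lt j k -> lt k p ->
  [/\ (red i j k -> red j k p -> red i j p),
      (~ red i j k -> ~ red j k p -> ~ red i j p) &
      (~ red i j k -> ~ red j k p -> ~ red i k p)].
  move=> iD jD kD pD ij jk kp.
  have jp := ltT _ _ _ jk kp; have ik := ltT _ _ _ ij jk.
  split.
  - rewrite /red => ljk lkp; rewrite ltNge; apply/negP => ljp.
    have ljk' := le_lt_trans ljp ljk.
    have b := bD _ _ jD pD jp; have t0 := lge0 _ _ jD pD jp.
    have := bump_before (bD _ _ jD kD jk) t0 ljk'.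
    have := bump_before (bD _ _ kD pD kp) t0 (lt_trans ljk' lkp).
    by rewrite (bump_eql b) => /lt_trans/[apply]; rewrite ltxx.
  - move=> bijk bjkp; rewrite /red => lijp.
    have rkp := blue_r _ _ _ jD kD pD jk kp bjkp.
    move: bijk bjkp => /negP; rewrite -leNgt => ljk /negP; rewrite -leNgt => lkp.
    have := bump_before (bD _ _ jD pD jp) (lge0 _ _ iD jD ij) lijp.
    have lijr : l i j < r k p.
      by apply: lt_trans lijp _; apply: lr_meet.
    have := @bump_le _ _ _ _ (l i j) (bD _ _ jD kD jk).
    rewrite ljk (ltW (lt_trans lijr rkp)) => /(_ isT) jk'.
    have := @bump_le _ _ _ _ (l i j) (bD _ _ kD pD kp).
    rewrite (le_trans lkp ljk) (ltW lijr) => /(_ isT) kp'.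
    by rewrite ltNge (le_trans jk' kp').
  - move=> /negP; rewrite -leNgt => ljk /negP; rewrite -leNgt => lkp.
    rewrite /red => likp.
    have likj : l i k < l j k := lt_le_trans likp lkp.
    have t0 := lge0 _ _ iD kD ik.
    have := bump_before (bD _ _ iD jD ij) t0 (lt_le_trans likj ljk).
    have := bump_before (bD _ _ jD kD jk) t0 likj.
    rewrite -(bump_eql (bD _ _ iD kD ik)) => /lt_trans/[apply].
    by rewrite ltxx.
have seen (s : seq T) j t : {subset s <= D} -> j \in s -> 0 <= t -> t <= P ->
    {in s, forall i, lt i j -> l i j < t < r i j} ->
    {in s, forall k, lt j k -> (t < l j k) || (r j k < t)} ->
    {in s, forall k, k != j -> f k t < f j t}.
  move=> sD js t0 tP below above k ks kj.
  have [jD kD] := (sD _ js, sD _ ks).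
  have /orP[kj'|jk] := ltD k j kD jD kj.
    by have /andP[] := below k ks kj'; apply: bump_in; apply: bD.
  have b := bD _ _ jD kD jk.
  by have /orP[/(bump_before b t0)|/(bump_after b)/(_ tP)] := above k ks jk.
(* All bumps over the least curve [j] start after 0, so [j] is on top at 0. *)
have first (s : seq T) j : {subset s <= D} -> j \in s -> ~~ has (lt^~ j) s ->
    exists t, {in s, forall k, k != j -> f k t < f j t}.
  move=> sD js /hasPn nj; exists 0.
  apply: seen => //; first exact: ltW.
    by move=> i /nj/negbTE->.
  by move=> k ks jk; rewrite (bump_l (bD _ _ (sD _ js) (sD _ ks) jk)).
have [[s [szs us sD cs]]|[s [szs us sD cs]]] :=
  erdos_szekeres ltI ltT ltD redE ltm; exists s; split=> // j js.
- have [/hasP[i0 i0s i0j]|nj] := boolP (has (lt^~ j) s); last exact: first.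
  (* The outer curve [i0] supplies the heads of the two lists. In the red case the ends [l j k] are
     upper bounds for [t]. *)
  have [|t [tlo thi]] := @exists_between R (l i0 j) (r i0 j)
      [seq l i j | i <- s & lt i j]
      ([seq r i j | i <- s & lt i j] ++ [seq l j k | k <- s & lt j k]).
    move=> x y; rewrite -(map_cons (fun i => l i j)) => /mapP[i iin ->].
    rewrite -cat_cons -(map_cons (fun i => r i j)) mem_cat.
    have {iin} [iin ij] : i \in s /\ lt i j.
      by move: iin; rewrite inE mem_filter => /predU1P[->|/andP[]].
    case/orP => /mapP[k + ->].
      rewrite inE mem_filter => /predU1P[->|/andP[kj ks]]; apply: lr_meet => //;
        exact: sD.
    by rewrite mem_filter => /andP[jk ks]; apply: cs.
  exists t; have l0t := tlo _ (mem_head _ _); have tr0 := thi _ (mem_head _ _).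
  have b0 := bD _ _ (sD _ i0s) (sD _ js) i0j.
  apply: seen => //.
  + exact: le_trans (ltW (bump_l b0)) (ltW l0t).
  + exact: le_trans (ltW tr0) (ltW (bump_r b0)).
  + move=> i iin ij; rewrite tlo ?thi //.
      by rewrite inE mem_cat map_f ?orbT // mem_filter ij.
    by rewrite inE map_f ?orbT // mem_filter ij.
  + move=> k kin jk; rewrite thi //.
    by rewrite inE mem_cat [X in _ || X]orbC map_f ?orbT // mem_filter jk.
- have [/hasP[i0 i0s i0j]|nj] := boolP (has (lt^~ j) s); last exact: first.
  (* In the blue case the ends [r j k] are lower bounds for [t]. *)
  have [|t [tlo thi]] := @exists_between R (l i0 j) (r i0 j)
      ([seq l i j | i <- s & lt i j] ++ [seq r j k | k <- s & lt j k])
      [seq r i j | i <- s & lt i j].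
    move=> x y; rewrite -cat_cons -(map_cons (fun i => l i j)) => + yin.
    move: yin; rewrite -(map_cons (fun i => r i j)) => /mapP[i iin ->].
    have {iin} [iin ij] : i \in s /\ lt i j.
      by move: iin; rewrite inE mem_filter => /predU1P[->|/andP[]].
    rewrite mem_cat => /orP[] /mapP[k + ->].
      rewrite inE mem_filter => /predU1P[->|/andP[kj ks]]; apply: lr_meet => //;
        exact: sD.
    by rewrite mem_filter => /andP[jk ks]; apply: blue_r; rewrite ?sD //; apply: cs.
  exists t; have l0t := tlo _ (mem_head _ _); have tr0 := thi _ (mem_head _ _).
  have b0 := bD _ _ (sD _ i0s) (sD _ js) i0j.
  apply: seen => //.
  + exact: le_trans (ltW (bump_l b0)) (ltW l0t).
  + exact: le_trans (ltW tr0) (ltW (bump_r b0)).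
  + move=> i iin ij; rewrite tlo ?thi //.
      by rewrite inE map_f ?orbT // mem_filter ij.
    by rewrite inE mem_cat map_f ?orbT // mem_filter ij.
  + move=> k kin jk; rewrite tlo ?orbT //.
    by rewrite inE mem_cat [X in _ || X]orbC map_f ?orbT // mem_filter jk.
Qed.

(** At [l i] and [r j] one of two curves meets [A] while the other is below it, which locates both
    crossings. A red clique is completed by [A] and needs only [m + 2] members, a blue one needs
    [m + 3]: hence the uneven binomial. *)
Lemma unnested_antichain (A : T) (l r : T -> R) (D : {set T}) m :
    {in D, forall j, A != j /\ bump A j (l j) (r j)} ->
    {in D &, forall i j, l i < l j -> r i < r j} ->
    ('C(m + m.+1, m) < #|D|)%N ->
  exists s, [/\ size s = m.+3, uniq s & all_visible s].
Proof.
move=> bA lrD ltm; have bD j jD := (bA j jD).2.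
pose lt : rel T := fun i j => l i < l j.
have ltI : irreflexive lt by move=> i; rewrite /lt ltxx.
have ltT : transitive lt by move=> j i k; apply: lt_trans.
have ltN i j : lt i j -> i != j by apply: contraTneq => ->; rewrite ltI.
have ltD : {in D &, forall i j, i != j -> lt i j || lt j i}.
  move=> i j iD jD ij; rewrite /lt -neq_lt; apply/eqP => E.
  have [[Ai bi] [Aj bj]] := (bA i iD, bA j jD).
  by apply: (no_triple Ai Aj ij (bump_eql bi)); rewrite E (bump_eql bj).
have lrP i : i \in D -> [/\ 0 < l i, l i < r i & r i < P].
  by move=> /bD b; rewrite (bump_l b) (bump_lr b) (bump_r b).
(* At [c.1] the curve [j] overtakes [i], at [c.2] it falls below [i] again. The latter may exceed
   [P], so the period considered starts at [l i]. *)
pose cross i j (c : R * R) :=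
  [/\ l i < c.1 < r j, f i c.1 = f j c.1,
      (forall t, l i <= t -> t < c.1 -> f j t < f i t) &
      (forall t, c.1 < t -> t <= r j -> f i t < f j t)] /\
  [/\ r j < c.2 < l i + P, f i c.2 = f j c.2,
      (forall t, r j <= t -> t < c.2 -> f i t < f j t) &
      (forall t, c.2 < t -> t <= l i + P -> f j t < f i t)].
have /choice[c cD] (ij : T * T) : exists c : R * R,
    ij.1 \in D -> ij.2 \in D -> lt ij.1 ij.2 -> cross ij.1 ij.2 c.
  have [|] := boolP [&& ij.1 \in D, ij.2 \in D & lt ij.1 ij.2]; last first.
    by move=> /negP n; exists (0, 0) => i j k; case: n; rewrite i j k.
  case: ij => i j /= /and3P[iD jD ij].
  have [bi bj] := (bD i iD, bD j jD).
  have [l0 lr rP] := lrP i iD; have [l0' lr' rP'] := lrP j jD.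
  have rij := lrD _ _ iD jD ij; have nij := ltN _ _ ij.
  have fl : f j (l i) < f i (l i).
    by rewrite -(bump_eql bi); exact: (bump_before bj (ltW l0) ij).
  have fr : f i (r j) < f j (r j).
    by rewrite -(bump_eqr bj); apply: (bump_after bi rij (ltW rP')).
  have [||x X] := crossing nij _ _ fl fr; [exact: lt_trans lr'| by lra|].
  have [|||||y Y] := @crossing j i (r j) (l i + P); rewrite ?f_per //.
  - by rewrite eq_sym.
  - by lra.
  - by rewrite ltrD2r (lt_trans ij).
  exists (x, y) => _ _ _; split=> //.
  by case: Y => ? /esym ? ? ?; split.
pose x i j := (c (i, j)).1; pose y i j := (c (i, j)).2.
have {}cD i j : i \in D -> j \in D -> lt i j -> cross i j (x i j, y i j).
  by move=> iD jD ij; rewrite /x /y -surjective_pairing; exact: (cD (i, j)).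
clearbody x y; clear c.
have x_bounds i j : i \in D -> j \in D -> lt i j -> l i < x i j < r j.
  by move=> iD jD /(cD i j iD jD)[[]].
have x_eq i j : i \in D -> j \in D -> lt i j -> f i (x i j) = f j (x i j).
  by move=> iD jD /(cD i j iD jD)[[]].
have x_before i j t : i \in D -> j \in D -> lt i j -> l i <= t -> t < x i j ->
    f j t < f i t.
  by move=> iD jD /(cD i j iD jD)[[_ _ + _] _]; apply.
have x_after i j t : i \in D -> j \in D -> lt i j -> x i j < t -> t <= r j ->
    f i t < f j t.
  by move=> iD jD /(cD i j iD jD)[[_ _ _ +] _]; apply.
have y_bounds i j : i \in D -> j \in D -> lt i j -> r j < y i j < l i + P.
  by move=> iD jD /(cD i j iD jD)[_ []].
have y_eq i j : i \in D -> j \in D -> lt i j -> f i (y i j) = f j (y i j).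
  by move=> iD jD /(cD i j iD jD)[_ []].
have y_before i j t : i \in D -> j \in D -> lt i j -> r j <= t -> t < y i j ->
    f i t < f j t.
  by move=> iD jD /(cD i j iD jD)[_ [_ _ + _]]; apply.
have y_after i j t : i \in D -> j \in D -> lt i j -> y i j < t -> t <= l i + P ->
    f j t < f i t.
  by move=> iD jD /(cD i j iD jD)[_ [_ _ _ +]]; apply.
(* Take [t] after [x i j] where [j] is above [i] and [k]. Being above [i] puts [t] before [y i j];
   since [t] is past [x j k], being above [k] means that [y j k] has been reached. *)
have blue_y i j k : i \in D -> j \in D -> k \in D -> lt i j -> lt j k ->
    ~ x i j < x j k -> y j k < y i j.
  move=> iD jD kD ij jk /negP; rewrite -leNgt => xjk.
  have ji : j != i by rewrite eq_sym ltN.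
  have [t [xt tx fi fk]] := visible3_window (x i j) ji (ltN _ _ jk)
    (ltN _ _ (ltT _ _ _ ij jk)).
  have {}xt : x i j < t.
    rewrite lt_neqAle xt andbT; apply/eqP => E.
    by move: fi; rewrite -E x_eq // ltxx.
  have ty : t < y i j.
    rewrite ltNge; apply/negP; rewrite le_eqVlt => /predU1P[E|yt].
      by move: fi; rewrite -E y_eq // ltxx.
    have [tl|lt'] := leP t (l i + P).
      by have := y_after _ _ _ iD jD ij yt tl; rewrite ltNge ltW.
    (* Beyond [l i + P], going back one period leads before [x i j], where [i] is on top. *)
    have : f j (t - P) < f i (t - P) by apply: x_before => //; lra.
    by rewrite -!(f_per _ (t - P)) subrK ltNge ltW.
  apply: le_lt_trans ty; rewrite leNgt; apply/negP => ty.
  have [tr|/ltW rt] := leP t (r k).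
    by have := x_after _ _ _ jD kD jk (le_lt_trans xjk xt) tr; rewrite ltNge ltW.
  by have := y_before _ _ _ jD kD jk rt ty; rewrite ltNge ltW.
pose red i j k := x i j < x j k.
(* The contradictions now sit at [x j p], [x i j] and [x i k]. If the first or the last comes too
   early for a comparison with the middle curve, then [A] itself lies strictly between the two
   curves that should meet. *)
have redE i j k p : i \in D -> j \in D -> k \in D -> p \in D ->
    lt i j -> lt j k -> lt k p ->
  [/\ (red i j k -> red j k p -> red i j p),
      (~ red i j k -> ~ red j k p -> ~ red i j p) &
      (~ red i j k -> ~ red j k p -> ~ red i k p)].
  move=> iD jD kD pD ij jk kp.
  have jp := ltT _ _ _ jk kp; have ik := ltT _ _ _ ij jk.
  have /andP[li_x x_rj] := x_bounds _ _ iD jD ij.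
  have /andP[lj_x x_rk] := x_bounds _ _ jD kD jk.
  have /andP[lk_x x_rp] := x_bounds _ _ kD pD kp.
  have rjk := lrD _ _ jD kD jk; have rkp := lrD _ _ kD pD kp.
  split.
  - rewrite /red => xjk xkp; rewrite ltNge; apply/negP => xjp.
    have /andP[l_xjp _] := x_bounds _ _ jD pD jp.
    have := x_before _ _ _ jD kD jk (ltW l_xjp) (le_lt_trans xjp xjk).
    have [lkx|xlk] := leP (l k) (x j p).
      have := x_before _ _ _ kD pD kp lkx (le_lt_trans xjp (lt_trans xjk xkp)).
      by rewrite x_eq // => /lt_trans/[apply]; rewrite ltxx.
    have := bump_in (bD j jD) l_xjp (le_lt_trans xjp x_rj).
    have [l0 _ _] := lrP j jD.
    have := bump_before (bD p pD) (ltW (lt_trans l0 l_xjp)) (lt_trans xlk kp).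
    by rewrite x_eq // => /lt_trans/[apply]; rewrite ltxx.
  - move=> /negP; rewrite -leNgt => xjk /negP; rewrite -leNgt => xkp.
    rewrite /red => xjp.
    have := x_before _ _ _ jD pD jp (ltW (lt_le_trans lj_x xjk)) xjp.
    have jk' : f j (x i j) <= f k (x i j).
      move: xjk; rewrite le_eqVlt => /predU1P[<-|xjk]; first by rewrite x_eq.
      by apply/ltW/x_after => //; apply/ltW/(lt_trans x_rj).
    have kp' : f k (x i j) <= f p (x i j).
      have := le_trans xkp xjk.
      rewrite le_eqVlt => /predU1P[<-|xkp']; first by rewrite x_eq.
      by apply/ltW/x_after => //; apply/ltW/(lt_trans x_rj)/(lt_trans rjk).
    by rewrite ltNge (le_trans jk' kp').
  - move=> /negP; rewrite -leNgt => xjk /negP; rewrite -leNgt => xkp.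
    rewrite /red => xik.
    have /andP[l_xik _] := x_bounds _ _ iD kD ik.
    have xikj := lt_le_trans xik xkp.
    have [ljx|xlj] := leP (l j) (x i k).
      have := x_before _ _ _ iD jD ij (ltW l_xik) (lt_le_trans xikj xjk).
      have := x_before _ _ _ jD kD jk ljx xikj.
      by rewrite -x_eq // => /lt_trans/[apply]; rewrite ltxx.
    have lj_xij : l j < x i j := lt_le_trans lj_x xjk.
    have x_ri : x i j < r i.
      have fij := x_eq _ _ iD jD ij.
      have fA : f A (x i j) < f i (x i j).
        by rewrite fij; apply: (bump_in (bD j jD) lj_xij x_rj).
      have [l0 _ _] := lrP i iD; have [_ _ rP] := lrP j jD.
      by have /andP[] := bump_lt (bD i iD) (ltW (lt_trans l0 li_x))
        (ltW (lt_trans x_rj rP)) fA.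
    have := bump_in (bD i iD) l_xik (lt_trans (lt_trans xlj lj_xij) x_ri).
    have [l0 _ _] := lrP i iD.
    have := bump_before (bD k kD) (ltW (lt_trans l0 l_xik)) (lt_trans xlj jk).
    by rewrite -x_eq // => /lt_trans/[apply]; rewrite ltxx.
have total (s : seq T) j k : {subset s <= D} -> j \in s -> k \in s -> k != j ->
    [/\ j \in D, k \in D & lt k j \/ lt j k].
  by move=> sD /sD jD /sD kD kj; split=> //; apply/orP/ltD.
have [[s [szs us sD cs]]|[s [szs us sD cs]]] := erdos_szekeres ltI ltT ltD redE ltm.
- exists (A :: s).
  have As : A \notin s by apply/negP => /sD/bA[]; rewrite eqxx.
  split; [by rewrite /= szs | by rewrite /= As|].
  move=> j; rewrite inE => /predU1P[->|js].
    exists 0 => k; rewrite inE => /predU1P[->|/sD/bD b _]; first by rewrite eqxx.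
    exact: (bump_before b (lexx _) (bump_l b)).
  have [l0 lr rP] := lrP j (sD j js).
  (* Staying between [l j] and [r j] keeps [j] above [A]. *)
  have [|t [tlo thi]] := @exists_between R (l j) (r j)
      [seq x i j | i <- s & lt i j] [seq x j k | k <- s & lt j k].
    move=> u v; rewrite !inE => /predU1P[->|/mapP[i]].
      case/predU1P => [->//|/mapP[k]]; rewrite mem_filter => /andP[jk ks ->].
      by have /andP[] := x_bounds _ _ (sD _ js) (sD _ ks) jk.
    rewrite mem_filter => /andP[ij iin ->] /predU1P[->|/mapP[k]].
      by have /andP[] := x_bounds _ _ (sD _ iin) (sD _ js) ij.
    by rewrite mem_filter => /andP[jk ks ->]; apply: cs.
  have lt' := tlo _ (mem_head _ _); have tr := thi _ (mem_head _ _).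
  exists t => k; rewrite inE => /predU1P[-> _|ks kj].
    exact: (bump_in (bD _ (sD _ js)) lt' tr).
  have [jD kD [kj'|jk]] := total s j k sD js ks kj.
    apply: x_after (ltW tr) => //.
    by apply: tlo; rewrite inE map_f ?orbT // mem_filter kj'.
  apply: x_before (ltW lt') _ => //.
  by apply: thi; rewrite inE map_f ?orbT // mem_filter jk.
- exists s; split=> // j js.
  have [l0 lr rP] := lrP j (sD j js).
  (* On this side [j] is below [A], which therefore has to be left out. *)
  have [|t [tlo thi]] := @exists_between R (r j) (l j + P)
      [seq y j k | k <- s & lt j k] [seq y i j | i <- s & lt i j].
    move=> u v; rewrite !inE => /predU1P[->|/mapP[k]].
      case/predU1P => [->|/mapP[i]]; first by lra.
      rewrite mem_filter => /andP[ij iin ->].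
      by have /andP[] := y_bounds _ _ (sD _ iin) (sD _ js) ij.
    rewrite mem_filter => /andP[jk ks ->] /predU1P[->|/mapP[i]].
      by have /andP[] := y_bounds _ _ (sD _ js) (sD _ ks) jk.
    rewrite mem_filter => /andP[ij iin ->].
    by apply: blue_y; rewrite ?sD //; apply: cs.
  have rt := tlo _ (mem_head _ _); have tl := thi _ (mem_head _ _).
  exists t => k ks kj.
  have [jD kD [kj'|jk]] := total s j k sD js ks kj.
    apply: y_before (ltW rt) _ => //.
    by apply: thi; rewrite inE map_f ?orbT // mem_filter kj'.
  apply: y_after (ltW tl) => //.
  by apply: tlo; rewrite inE map_f ?orbT // mem_filter jk.
Qed.

(** At both ends of the inner interval [j] meets [A], so it is below [i]; somewhere inside it is
    above [i]. By [two_cross] it then cannot reach [i] outside, in particular at 0. *)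
Lemma nested_bump A i j l r l' r' : A != i -> A != j -> i != j ->
  bump A i l r -> bump A j l' r' -> l < l' -> r' < r ->
  exists u v, bump i j u v.
Proof.
move=> Ai Aj ij bi bj ll' r'r.
have jA : j != A by rewrite eq_sym.
have ji : j != i by rewrite eq_sym.
have [t [t0 tP fA fi]] := visible3_window 0 jA ji Ai.
rewrite add0r in tP.
have /andP[lt tr] := bump_lt bj t0 (ltW tP) fA.
have lr' := bump_lr bj; have l'0 := bump_l bj; have r'P := bump_r bj.
have fl : f j l' < f i l'.
  by rewrite -(bump_eql bj); apply: (bump_in bi) => //; lra.
have fr : f j r' < f i r'.
  by rewrite -(bump_eqr bj); apply: (bump_in bi) => //; lra.
have outside s : 0 <= s -> s <= P -> ~~ (l' < s < r') -> f j s < f i s.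
  move=> s0 sP; case: (ltgtP s l') => [sl _|ls /=|-> //].
  - rewrite ltNge; apply/negP => ijs.
    have rsP : r' < s + P by lra.
    exact: (two_cross ji sl lt tr rsP ijs (ltW fl) (ltW fi) (ltW fr)).
  - rewrite -leNgt le_eqVlt => /predU1P[<-//|rs].
    rewrite ltNge; apply/negP => ijs.
    have slP : s < l' + P by lra.
    exact: (two_cross ij lt tr rs slP (ltW fl) (ltW fi) (ltW fr) ijs).
by apply: (@bump_exists i j t) => //; [lra | apply: outside => //; lra].
Qed.

Lemma convex_subsystem n : (3 <= n)%N ->
    (('C(2 * n - 5, n - 2) + 1) * 'C(2 * n - 4, n - 2) + 1 <= #|T|)%N ->
  exists s, [/\ size s = n, uniq s & all_visible s].
Proof.
case: n => [|[|[|m]]] // _.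
have -> : (2 * m.+3 - 5 = m + m.+1)%N by lia.
have -> : (2 * m.+3 - 4 = m.+1 + m.+1)%N by lia.
have -> : (m.+3 - 2 = m.+1)%N by lia.
have -> : 'C(m + m.+1, m.+1) = 'C(m + m.+1, m).
  by rewrite -bin_sub ?leq_addl // addnK.
(* With [n = m + 3], [B] is the bound for antichains and [a] the one for chains. *)
set B := 'C(_, m); set a := 'C(_, _) => cardT.
have a2 : (2 <= a)%N.
  rewrite /a addSn binS.
  have : (0 < 'C(m + m.+1, m.+1))%N by rewrite bin_gt0 leq_addl.
  have : (0 < 'C(m + m.+1, m))%N by rewrite bin_gt0 leq_addr.
  lia.
have B1 : (0 < B)%N by rewrite bin_gt0 leq_addr.
have T3 : (3 <= #|T|)%N by nia.
have /card_gt0P[i0 _] : (0 < #|T|)%N by lia.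
pose A := [arg max_(i > i0) f i 0]%O.
have Amax i : f i 0 <= f A 0.
  by rewrite /A; case: arg_maxP => // k _; apply.
pose T' := [set j | f j 0 < f A 0].
(* At most two curves attain the maximum at 0; as [2 <= a], more than [a * B] remain without
   them. *)
have cT' : (#|~: T'| <= 2)%N.
  rewrite leqNgt; apply/negP => /card_gt2P[i [j [k [[iT jT kT] [ij jk ki]]]]].
  have E u : u \in ~: T' -> f u 0 = f A 0.
    by rewrite !inE -leNgt => Au; apply/eqP; rewrite eq_le Amax.
  by apply: (no_triple ij _ jk (t := 0)); rewrite 1?eq_sym ?E.
have {cardT} {}cT' : (a * B < #|T'|)%N.
  by have := cardsC T'; nia.
have bA j : j \in T' -> A != j /\ exists lr : R * R, bump A j lr.1 lr.2.
  rewrite inE => jA.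
  have Aj : A != j by apply: contraTneq jA => ->; rewrite ltxx.
  split=> //.
  (* A third curve is chosen because [visible3] speaks of three. *)
  have [k Ak jk] : exists2 k, A != k & j != k.
    have /card_gt0P[k] : (0 < #|~: [set A; j]|)%N.
      by move: T3; rewrite -(cardsC [set A; j]) cards2 Aj !addSn !ltnS.
    by rewrite !inE negb_or ![k == _]eq_sym => /andP[? ?]; exists k.
  have jA' : j != A by rewrite eq_sym.
  have [t [t0 tP fA _]] := visible3_window 0 jA' jk Ak.
  have [||||l [r b]] := @bump_exists A j t Aj; last by exists (l, r).
  - by rewrite lt_neqAle t0 andbT; apply/eqP => E; move: fA; rewrite -E ltNge ltW.
  - by rewrite add0r in tP.
  - by [].
  - by [].
have /choice[lr lrP] j : exists lr : R * R, j \in T' -> bump A j lr.1 lr.2.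
  have [/bA[_ [lr b]]|_] := boolP (j \in T'); first by exists lr.
  by exists (0, 0).
have {}bA : {in T', forall j, A != j /\ bump A j (lr j).1 (lr j).2}.
  by move=> j jT; split; [have [] := bA j jT | exact: lrP].
pose nest : rel T := fun i j => ((lr i).1 < (lr j).1) && ((lr j).2 < (lr i).2).
have nestI : irreflexive nest by move=> i; rewrite /nest ltxx.
have nestT : transitive nest.
  move=> j i k /andP[l1 r1] /andP[l2 r2].
  by rewrite /nest (lt_trans l1) // (lt_trans r2).
have r_inj : {in T' &, forall i j, (lr i).2 = (lr j).2 -> i = j}.
  move=> i j iT jT E; apply/eqP; apply/negPn/negP => ij.
  have [[Ai bi] [Aj bj]] := (bA i iT, bA j jT).
  by apply: (no_triple Ai Aj ij (bump_eqr bi)); rewrite E (bump_eqr bj).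
have [[s [szs ss sT]]|[S [ST cS Santi]]] := mirsky nestI nestT cT'; last first.
  apply: (@unnested_antichain A (fun j => (lr j).1) (fun j => (lr j).2) S) => //.
    by move=> j /(fintype.subsetP ST)/bA.
  (* The antichain leaves [r i <= r j]; equality would make [A], [i] and [j] meet in one point. *)
  move=> i j iS jS lij; have := Santi i j iS jS.
  rewrite /nest lij /= -leNgt le_eqVlt => /predU1P[E|//].
  have ij := r_inj i j (fintype.subsetP ST _ iS) (fintype.subsetP ST _ jS) E.
  by move: lij; rewrite ij ltxx.
have us : uniq s by apply: sorted_uniq ss.
have /choice[uv uvP] (ij : T * T) : exists uv : R * R, ij.1 \in T' ->
    ij.2 \in T' -> nest ij.1 ij.2 -> bump ij.1 ij.2 uv.1 uv.2.
  have [|] := boolP [&& ij.1 \in T', ij.2 \in T' & nest ij.1 ij.2]; last first.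
    by move=> /negP n; exists (0, 0) => i j k; case: n; rewrite i j k.
  case: ij => i j /= /and3P[iT jT nij]; have /andP[lij rij] := nij.
  have ij : i != j by apply: contraTneq nij => ->; rewrite nestI.
  have [[Ai bi] [Aj bj]] := (bA i iT, bA j jT).
  by have [u [v b]] := nested_bump Ai Aj ij bi bj lij rij; exists (u, v).
have total : {in s &, forall x y, x != y -> nest x y || nest y x}.
  move: ss; rewrite (sorted_pairwise nestT).
  elim: (s) => [|z t IH]; first by move=> x y; rewrite in_nil.
  move=> /= /andP[/allP zt /IH tt] x y; rewrite !inE.
  move=> /predU1P[->|xt] /predU1P[->|yt]; rewrite ?eqxx //.
  - by rewrite zt.
  - by rewrite zt ?orbT.
  - exact: tt.
apply: (@nested_chain nest (fun i j => (uv (i, j)).1) (fun i j => (uv (i, j)).2)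
  [set x in s] m.+1) => //.
- by move=> x y; rewrite !inE; apply: total.
- by move=> i j; rewrite !inE => /sT iT /sT jT; apply: (uvP (i, j)).
- by rewrite cardsE (card_uniqP us) szs.
Qed.

End CurveSystem.

(** * Support functions of planar convex bodies *)

Local Open Scope classical_set_scope.
Local Open Scope ring_scope.

Section Plane.
Variable R : realType.
Implicit Types (u x y : plane R) (A B : set (plane R)) (t : R).

Lemma dotpE u x : dotp u x = u 0 0 * x 0 0 + u 0 1 * x 0 1.
Proof.
rewrite /dotp big_ord_recl big_ord_recl big_ord0 addr0.
by congr (u _ _ * x _ _ + u _ _ * x _ _); apply/val_inj.
Qed.

Lemma dotpDr u x y : dotp u (x + y) = dotp u x + dotp u y.
Proof. by rewrite !dotpE !mxE; ring. Qed.

Lemma dotpZr u a x : dotp u (a *: x) = a * dotp u x.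
Proof. by rewrite !dotpE !mxE; ring. Qed.

Lemma dotpDl u x y : dotp (x + y) u = dotp x u + dotp y u.
Proof. by rewrite !dotpE !mxE; ring. Qed.

Lemma dotpZl u a x : dotp (a *: x) u = a * dotp x u.
Proof. by rewrite !dotpE !mxE; ring. Qed.

Lemma convex_comb A x y a b : convex_set A -> A x -> A y ->
  0 <= a -> 0 <= b -> a + b = 1 -> A (a *: x + b *: y).
Proof.
move=> cA Ax Ay a0 b0 ab.
have a1 : a <= 1 by lra.
pose l : {i01 R} := Itv01 a0 a1.
have := cA x y l; rewrite !inE => /(_ Ax Ay).
have -> // : conv l (x : convex_lmodType _) y = a *: x + b *: y.
by have -> : b = 1 - a by lra.
Qed.

Lemma convex_setP A : (forall x y a b, A x -> A y -> 0 <= a -> 0 <= b ->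
  a + b = 1 -> A (a *: x + b *: y)) -> convex_set A.
Proof.
move=> H x y l; rewrite !inE => Ax Ay.
have Hl : A (l%:num *: x + (1 - l%:num) *: y).
  by apply: H => //; rewrite addrC subrK.
exact: Hl.
Qed.

Lemma continuous_dotp u : continuous (dotp u).
Proof.
move=> x; rewrite [dotp u](_ : _ = fun x => u 0 0 * x 0 0 + u 0 1 * x 0 1); last first.
  by apply/funext => y; rewrite dotpE.
have c i : {for x, continuous (fun y : plane R => u 0 i * y 0 i)}.
  apply: (@continuousM _ _ (fun=> u 0 i)); first exact: cst_continuous.
  exact: coord_continuous.
exact: (continuousD (c 0) (c 1)).
Qed.

Definition supp A u : R := sup [set dotp u x | x in A].

Lemma dotp_attained A u : compact A -> A !=set0 ->
  exists2 p, A p & forall x, A x -> dotp u x <= dotp u p.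
Proof.
move=> cA A0; have [|p] := compact_EVT_max A0 cA (f := dotp u).
  exact/continuous_subspaceT/continuous_dotp.
by rewrite inE => Ap pmax; exists p => // x Ax; apply: pmax; rewrite inE.
Qed.

Lemma suppP A u : compact A -> A !=set0 ->
  exists p, [/\ A p, supp A u = dotp u p & forall x, A x -> dotp u x <= supp A u].
Proof.
move=> cA A0; have [p Ap pmax] := dotp_attained u cA A0.
have E : supp A u = dotp u p.
  apply/eqP; rewrite eq_le; apply/andP; split.
    by apply: ge_sup; [exists (dotp u p), p | move=> _ [x Ax <-]; apply: pmax].
  by apply: ub_le_sup; [exists (dotp u p) => _ [x Ax <-]; apply: pmax | exists p].
by exists p; rewrite E; split.
Qed.

(* The nearest points p, q of two disjoint compact convex sets: q - p separates. *)
Lemma strict_separation A B : compact A -> convex_set A -> A !=set0 ->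
  compact B -> convex_set B -> B !=set0 -> A `&` B = set0 ->
  exists w, forall p q, A p -> B q -> dotp w p < dotp w q.
Proof.
move=> kA cA [a Aa] kB cB [b Bb] AB.
pose d (z : plane R * plane R) :=
  (z.2 0 0 - z.1 0 0) ^+ 2 + (z.2 0 1 - z.1 0 1) ^+ 2.
have [||[p q]] := @compact_EVT_min _ R d (A `*` B) _ (compact_setX kA kB).
- by exists (a, b).
- apply: continuous_subspaceT => z.
  have c1 i : (fun z : plane R * plane R => z.1 0 i) @ z --> z.1 0 i.
    apply: (@cvg_comp _ _ _ fst (fun x : plane R => x 0 i)); first exact: cvg_fst.
    exact: coord_continuous.
  have c2 i : (fun z : plane R * plane R => z.2 0 i) @ z --> z.2 0 i.
    apply: (@cvg_comp _ _ _ snd (fun x : plane R => x 0 i)); first exact: cvg_snd.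
    exact: coord_continuous.
  by apply: cvgD; apply: (cvgM (cvgB _ _) (cvgB _ _)).
rewrite inE => -[/= Ap Bq] dmin.
have pq : 0 < d (p, q).
  rewrite lt_neqAle addr_ge0 ?sqr_ge0 // andbT eq_sym /d /=.
  rewrite paddr_eq0 ?sqr_ge0 // !sqrf_eq0 !subr_eq0.
  apply/negP => /andP[/eqP q0 /eqP q1].
  have E : q = p.
    apply/rowP => i; case: i => -[|[|//]] i2.
      by rewrite (_ : Ordinal i2 = 0) //; apply/val_inj.
    by rewrite (_ : Ordinal i2 = 1) //; apply/val_inj.
  have : (A `&` B) p by split=> //; rewrite -E.
  by rewrite AB.
pose w := q - p.
(* The squared distance along a segment leaving a nearest point has nonnegative slope; otherwise it
   would drop at the vertex [- g / (2 * e)] of the quadratic or, if that is out of reach, at 1. *)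
have quad (g e : R) : (forall s, 0 < s -> s <= 1 -> 0 <= s * g + s ^+ 2 * e) -> 0 <= g.
  move=> H; rewrite leNgt; apply/negP => g0.
  have [e0|e0] := leP e 0; first by have := H 1 ltr01 (lexx _); nra.
  have [le1|] := leP (- g / (2 * e)) 1; last first.
    by rewrite ltr_pdivlMr ?mulr_gt0 // => ?; have := H 1 ltr01 (lexx _); nra.
  have /H/(_ le1) : 0 < - g / (2 * e) by rewrite divr_gt0 ?mulr_gt0 ?oppr_gt0.
  rewrite (_ : _ + _ = - (g ^+ 2 / (4 * e))); last by field; rewrite gt_eqF.
  have g2 : 0 < g ^+ 2 by rewrite exprn_even_gt0 //= lt_eqF.
  by rewrite oppr_ge0 leNgt divr_gt0 // mulr_gt0.
exists w => x y Ax By.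
have wpq : dotp w p < dotp w q.
  rewrite -subr_gt0; move: pq; rewrite /d /w !dotpE !mxE /=; nra.
have wx : dotp w x <= dotp w p.
  rewrite -subr_ge0.
  suff : 0 <= 2 * (dotp w p - dotp w x) by lra.
  apply: (@quad _ (dotp (x - p) (x - p))) => s s0 s1.
  have Az : A ((1 - s) *: p + s *: x) by apply: convex_comb => //; lra.
  have := dmin ((1 - s) *: p + s *: x, q); rewrite inE /= => /(_ (conj Az Bq)).
  rewrite /d /w !dotpE !mxE /=; nra.
have wy : dotp w q <= dotp w y.
  rewrite -subr_ge0.
  suff : 0 <= 2 * (dotp w y - dotp w q) by lra.
  apply: (@quad _ (dotp (y - q) (y - q))) => s s0 s1.
  have Bz : B ((1 - s) *: q + s *: y) by apply: convex_comb => //; lra.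
  have := dmin (p, (1 - s) *: q + s *: y); rewrite inE /= => /(_ (conj Ap Bz)).
  rewrite /d /w !dotpE !mxE /=; nra.
lra.
Qed.

(** * Unit directions and the support function of an angle *)

Definition dir (t : R) : plane R := \row_i (if i == 0 then cos t else sin t).

Lemma dotp_dir t x : dotp (dir t) x = cos t * x 0 0 + sin t * x 0 1.
Proof. by rewrite dotpE !mxE. Qed.

Lemma dir_neq0 t : dir t != 0.
Proof.
apply/eqP => /rowP d0; have := cos2Dsin2 t.
have := d0 0; have := d0 1; rewrite !mxE /= => -> ->.
by rewrite expr0n /= addr0 => /eqP; rewrite eq_sym oner_eq0.
Qed.

Lemma dirD2pi t : dir (t + 2 * pi) = dir t.
Proof.
by apply/rowP => i; rewrite !mxE mulrDl !mul1r addrA !(cosDpi, sinDpi) !opprK.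
Qed.

(** Polar coordinates: [acos] gives the angle in the upper half plane, its negative serves the lower
    one. *)
Lemma dir_onto u : u != 0 -> exists t a, 0 < a /\ u = a *: dir t.
Proof.
move=> u0; pose a := Num.sqrt (u 0 0 ^+ 2 + u 0 1 ^+ 2).
have s0 : 0 < u 0 0 ^+ 2 + u 0 1 ^+ 2.
  rewrite lt_neqAle addr_ge0 ?sqr_ge0 // andbT eq_sym.
  apply: contra u0; rewrite paddr_eq0 ?sqr_ge0 // !sqrf_eq0 => /andP[/eqP x0 /eqP y0].
  apply/eqP/rowP => i; rewrite mxE; case: i => -[|[|//]] i2.
    by rewrite (_ : Ordinal i2 = 0) //; apply/val_inj.
  by rewrite (_ : Ordinal i2 = 1) //; apply/val_inj.
have a0 : 0 < a by rewrite sqrtr_gt0.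
have a2 : a ^+ 2 = u 0 0 ^+ 2 + u 0 1 ^+ 2 by rewrite sqr_sqrtr // ltW.
clearbody a.
have xa : -1 <= u 0 0 / a <= 1.
  rewrite ler_pdivlMr // ler_pdivrMr //.
  by have y2 := sqr_ge0 (u 0 1); apply/andP; split; nra.
pose s := acos (u 0 0 / a).
have cs : a * cos s = u 0 0 by rewrite acosK ?in_itv //= mulrC divfK ?gt_eqF.
have ss : a * sin s = `|u 0 1|.
  rewrite sin_acos // -{1}[a]ger0_norm ?ltW // -!sqrtr_sqr -sqrtrM ?sqr_ge0 //.
  congr Num.sqrt.
  have -> : u 0 1 ^+ 2 = a ^+ 2 - u 0 0 ^+ 2 by rewrite a2 addrC addKr.
  by field; rewrite gt_eqF.
have [y0|y0] := leP 0 (u 0 1).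
  exists s, a; split=> //; apply/rowP => i; rewrite !mxE; case: i => -[|[|//]] i2.
    by rewrite (_ : Ordinal i2 = 0) ?cs //; apply/val_inj.
  by rewrite (_ : Ordinal i2 = 1) ?ss ?ger0_norm //; apply/val_inj.
exists (- s), a; split=> //; apply/rowP => i; rewrite !mxE; case: i => -[|[|//]] i2.
  by rewrite (_ : Ordinal i2 = 0) ?cosN ?cs //; apply/val_inj.
rewrite (_ : Ordinal i2 = 1) ?sinN ?mulrN ?ss ?ltr0_norm ?opprK //; exact/val_inj.
Qed.

(** With [M] bounding the absolute coordinates on [A], a change of angle alters the maximum by at
    most [M] times the changes of cosine and sine. *)
Lemma supp_continuous A : compact A -> A !=set0 -> continuous (fun t => supp A (dir t)).
Proof.
move=> cA A0 s.
have [|m _ mP] := compact_EVT_max A0 cA (f := fun x => `|x 0 0| + `|x 0 1|).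
  apply: continuous_subspaceT => x.
  have c i : {for x, continuous (fun y : plane R => `|y 0 i|)}.
    apply: (@continuous_comp _ _ _ (fun y : plane R => y 0 i) (fun z : R => `|z|)).
      exact: coord_continuous.
    exact: norm_continuous.
  exact: (continuousD (c 0) (c 1)).
set M := _ + _ in mP.
have M0 : 0 <= M by rewrite addr_ge0.
pose k t := M * (`|cos t - cos s| + `|sin t - sin s|).
have le t t' : supp A (dir t) <= supp A (dir t') +
    M * (`|cos t - cos t'| + `|sin t - sin t'|).
  have [p [Ap -> _]] := suppP (dir t) cA A0.
  have [_ [_ _ /(_ p Ap)]] := suppP (dir t') cA A0.
  suff : dotp (dir t) p - dotp (dir t') p <=
     M * (`|cos t - cos t'| + `|sin t - sin t'|) by lra.
  rewrite !dotp_dir; have : p \in A by rewrite inE.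
  move=> /mP; have := ler_norm ((cos t - cos t') * p 0 0).
  have := ler_norm ((sin t - sin t') * p 0 1); rewrite !normrM.
  have := normr_ge0 (p 0 0); have := normr_ge0 (p 0 1).
  have := normr_ge0 (cos t - cos t'); have := normr_ge0 (sin t - sin t').
  move: `|p 0 0| `|p 0 1| `|cos t - cos t'| `|sin t - sin t'| => X Y U V; nra.
have k0 : k t @[t --> s] --> 0.
  have -> : 0 = k s by rewrite /k !subrr normr0 addr0 mulr0.
  have c (h : R -> R) : {for s, continuous h} ->
      {for s, continuous (fun t => `|h t - h s|)}.
    move=> hs; apply: (@continuous_comp _ _ _ (fun t => h t - h s) (fun z : R => `|z|)).
      by apply: continuousB => //; exact: cst_continuous.
    exact: norm_continuous.
  suff : {for s, continuous (fun t => M * (`|cos t - cos s| + `|sin t - sin s|))}.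
    exact.
  apply: (@continuousM _ _ (fun=> M)); first exact: cst_continuous.
  have cc := c _ (@continuous_cos R s); have cs := c _ (@continuous_sin R s).
  exact: (continuousD cc cs).
have lo : supp A (dir s) - k t @[t --> s] --> supp A (dir s).
  by rewrite -[X in _ --> X]subr0; apply: cvgB => //; exact: cvg_cst.
have hi : supp A (dir s) + k t @[t --> s] --> supp A (dir s).
  by rewrite -[X in _ --> X]addr0; apply: cvgD => //; exact: cvg_cst.
suff : supp A (dir t) @[t --> s] --> supp A (dir s) by [].
apply: squeeze_cvgr lo hi; apply: nearW => t; have := le t s; have := le s t.
rewrite (distrC (cos s)) (distrC (sin s)) -/(k t); lra.
Qed.

(* Moving from w towards - w along either half circle, the sign of the
   difference of the support functions can only change from - to +. *)
Lemma supp_lt_trans A B w u v a b c : compact A -> A !=set0 ->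
    compact B -> B !=set0 -> (forall p q, A p -> B q -> dotp w p < dotp w q) ->
    0 < a -> 0 <= b -> 0 < c -> a *: v = b *: u + c *: (- w) ->
  supp B u <= supp A u -> supp B v < supp A v.
Proof.
move=> kA A0 kB B0 sep a0 b0 c0 E BA.
have [p [Ap Ep _]] := suppP u kA A0; have [q [Bq Eq _]] := suppP v kB B0.
have [_ [_ _ /(_ q Bq) qB]] := suppP u kB B0.
have [_ [_ _ /(_ p Ap) pA]] := suppP v kA A0.
have wpq := sep p q Ap Bq.
have Ev x : a * dotp v x = b * dotp u x - c * dotp w x.
  by rewrite -dotpZl E dotpDl !dotpZl -scaleN1r dotpZl; ring.
rewrite -(ltr_pM2l a0); apply: lt_le_trans (_ : a * dotp v p <= _); last first.
  by rewrite ler_pM2l.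
rewrite Eq !Ev; nra.
Qed.

(** In the direction [phi] of a separating vector [B] is strictly ahead. On either half circle
    leading away from [phi], once [A] has caught up it stays strictly ahead, so the lead cannot
    alternate four times. *)
Lemma supp_two_cross A B a b c d : compact A -> convex_set A -> A !=set0 ->
    compact B -> convex_set B -> B !=set0 -> A `&` B = set0 ->
    a < b -> b < c -> c < d -> d < a + 2 * pi ->
    supp B (dir a) <= supp A (dir a) -> supp A (dir b) <= supp B (dir b) ->
    supp B (dir c) <= supp A (dir c) -> supp A (dir d) <= supp B (dir d) -> False.
Proof.
move=> kA cA A0 kB cB B0 AB ab bc cd da fa fb fc fd.
have [w sepw] := strict_separation kA cA A0 kB cB B0 AB.
have [[p0 Ap0] [q0 Bq0]] := (A0, B0).
have w0 : w != 0.
  apply/eqP => w0; have := sepw p0 q0 Ap0 Bq0.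
  by rewrite w0 -(scale0r 0) !dotpZl !mul0r ltxx.
have [phi0 [r [r0 wE]]] := dir_onto w0.
have pi0 := pi_gt0 R.
have [phi [phi1 phi2 dphi]] : exists phi, [/\ a - pi <= phi, phi < a + pi &
    dir phi = dir phi0].
  have per (i : bool) t : (if i then @cos R else @sin R) (t + 2 * pi) =
      (if i then @cos R else @sin R) t.
    case: i; by rewrite mulrDl !mul1r addrA !(cosDpi, sinDpi) !opprK.
  have P0 : 0 < 2 * pi :> R by lra.
  have [phi [h1 h2 h3]] := periodic_shift P0 per (a - pi) phi0.
  exists phi; split=> //; first by move: h2; lra.
  by apply/rowP => i; rewrite !mxE (h3 true) (h3 false).
have sep p q : A p -> B q -> dotp (dir phi) p < dotp (dir phi) q.
  by move=> Ap Bq; have := sepw p q Ap Bq; rewrite wE !dotpZl ltr_pM2l // dphi.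
have fphi z : dir z = dir phi -> supp B (dir z) <= supp A (dir z) -> False.
  move=> ->; have [p [Ap -> _]] := suppP (dir phi) kA A0.
  have [q [Bq -> _]] := suppP (dir phi) kB B0.
  by rewrite leNgt sep.
(* The linear relation between three unit vectors that [supp_lt_trans] asks for; the sines have the
   right signs within a half circle starting or ending at [z]. *)
have identity s t z : sin (s - z) *: dir t =
    sin (t - z) *: dir s + sin (t - s) *: (- dir z).
  apply/rowP => i; rewrite !mxE; case: ifP => _; rewrite !sinB;
  have := cos2Dsin2 s; have := cos2Dsin2 t; have := cos2Dsin2 z; nra.
have up z s t : dir z = dir phi -> z <= s -> s < t -> t <= z + pi ->
    supp B (dir s) <= supp A (dir s) -> supp B (dir t) < supp A (dir t).
  move=> dz zs st tz fs.
  have {}zs : z < s.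
    by rewrite lt_neqAle zs andbT; apply/eqP => E; apply: (fphi z dz); rewrite E.
  apply: (supp_lt_trans kA A0 kB B0 sep _ _ _ _ fs).
  - apply: (_ : 0 < sin (s - z)); apply: sin_gt0_pi; lra.
  - apply: (_ : 0 <= sin (t - z)); apply: sin_ge0_pi; lra.
  - apply: (_ : 0 < sin (t - s)); apply: sin_gt0_pi; lra.
  - by rewrite identity dz.
have down z s t : dir z = dir phi -> z - pi <= t -> t < s -> s <= z ->
    supp B (dir s) <= supp A (dir s) -> supp B (dir t) < supp A (dir t).
  move=> dz zt ts sz fs.
  have {}sz : s < z.
    by rewrite lt_neqAle sz andbT; apply/eqP => E; apply: (fphi z dz); rewrite -E.
  apply: (supp_lt_trans kA A0 kB B0 sep _ _ _ _ fs).
  - apply: (_ : 0 < sin (z - s)); apply: sin_gt0_pi; lra.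
  - apply: (_ : 0 <= sin (z - t)); apply: sin_ge0_pi; lra.
  - apply: (_ : 0 < sin (s - t)); apply: sin_gt0_pi; lra.
  - have := identity s t z; rewrite -[s - z]opprB -[t - z]opprB -[t - s]opprB.
    rewrite dz !sinN !scaleNr => /(congr1 -%R); by rewrite opprD !opprK.
have phi2pi : dir (phi + 2 * pi) = dir phi := dirD2pi phi.
have fa2 : supp B (dir (a + 2 * pi)) <= supp A (dir (a + 2 * pi)) by rewrite dirD2pi.
have nb : supp B (dir b) < supp A (dir b) -> False by rewrite ltNge fb.
have nd : supp B (dir d) < supp A (dir d) -> False by rewrite ltNge fd.
(* In each case two successive angles, with [a + 2 * pi] following [d], lie on one half circle in an
   order that [up] or [down] forbids. *)
have [pa|ap] := leP phi a.
  have [bp|pb] := leP b (phi + pi); first by apply: nb; apply: (up phi a).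
  have [cp|pc] := leP c (phi + 2 * pi).
    by apply: nb; apply: (down (phi + 2 * pi) c) => //; lra.
  by apply: nd; apply: (up (phi + 2 * pi) c) => //; lra.
have [cp|pc] := leP c phi.
  by apply: nb; apply: (down phi c) => //; lra.
have [dp|pd] := leP d (phi + pi); first by apply: nd; apply: (up phi c) => //; lra.
by apply: nd; apply: (down (phi + 2 * pi) (a + 2 * pi)) => //; lra.
Qed.

(** * Joins of two sets, convex hulls and convex position *)

Definition join_set B C : set (plane R) :=
  [set z.1 *: z.2.1 + (1 - z.1) *: z.2.2 | z in `[0, 1]%classic `*` (B `*` C)].

(** Writing the hull of two nonempty convex sets as the image of a product gives at once the
    compactness needed for strict separation. *)
Lemma join_set_compact B C : compact B -> compact C -> compact (join_set B C).
Proof.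
move=> kB kC; apply: continuous_compact; last first.
  by apply: compact_setX; [exact: segment_compact | exact: compact_setX].
apply: continuous_subspaceT => z.
have c1 : (fun z : R * (plane R * plane R) => z.1) @ z --> z.1 by exact: cvg_fst.
have c2 : (fun z : R * (plane R * plane R) => z.2) @ z --> z.2 by exact: cvg_snd.
have c3 : (fun z : R * (plane R * plane R) => z.2.1) @ z --> z.2.1.
  by apply: (@cvg_comp _ _ _ snd fst _ _ _ c2); exact: cvg_fst.
have c4 : (fun z : R * (plane R * plane R) => z.2.2) @ z --> z.2.2.
  by apply: (@cvg_comp _ _ _ snd snd _ _ _ c2); exact: cvg_snd.
have c5 : (fun z : R * (plane R * plane R) => 1 - z.1) @ z --> 1 - z.1.
  by apply: cvgB => //; exact: cvg_cst.
exact: (cvgD (cvgZ c1 c3) (cvgZ c5 c4)).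
Qed.

Lemma convex_comb_scaled B x y a b : convex_set B -> B x -> B y ->
  0 <= a -> 0 <= b -> exists2 z, B z & a *: x + b *: y = (a + b) *: z.
Proof.
move=> cB Bx By a0 b0; have [ab|ab] := eqVneq (a + b) 0.
  have [-> ->] : a = 0 /\ b = 0 by split; lra.
  by exists x => //; rewrite !scale0r !addr0 scale0r.
have ab0 : 0 < a + b by rewrite lt_neqAle eq_sym ab addr_ge0.
exists ((a / (a + b)) *: x + (b / (a + b)) *: y).
  by apply: convex_comb => //; rewrite ?divr_ge0 ?(ltW ab0) // -mulrDl divff.
by rewrite scalerDr !scalerA !(mulrC (a + b)) !divfK.
Qed.

Lemma join_set_convex B (C : set (plane R)) :
  convex_set B -> convex_set C -> convex_set (join_set B C).
Proof.
move=> cB cC; apply: convex_setP => _ _ a b [[s [p q]] /= [s01 [Bp Cq]] <-]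
  [[t [p' q']] /= [t01 [Bp' Cq']] <-] a0 b0 ab.
move: s01 t01; rewrite !in_itv /= => /andP[s0 s1] /andP[t0 t1].
have [x Bx Ex] := convex_comb_scaled cB Bp Bp' (mulr_ge0 a0 s0) (mulr_ge0 b0 t0).
have [||y Cy Ey] := @convex_comb_scaled C q q' (a * (1 - s)) (b * (1 - t)) cC Cq Cq'.
- by apply: mulr_ge0 => //; lra.
- by apply: mulr_ge0 => //; lra.
exists (a * s + b * t, (x, y)) => /=.
  by split; [rewrite in_itv /=; apply/andP; split; nra | split].
rewrite -Ex (_ : 1 - _ = a * (1 - s) + b * (1 - t)); last by lra.
rewrite -Ey !scalerDr !scalerA addrACA //.
Qed.

Lemma conv_hull_convex (S : set (plane R)) : convex_set (conv_hull S).
Proof.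
apply: convex_setP => x y a b Sx Sy a0 b0 ab K [cK SK].
by apply: convex_comb => //; [apply: Sx | apply: Sy].
Qed.

Lemma sub_conv_hull S : S `<=` @conv_hull R S.
Proof. exact: sub_smallest. Qed.

Lemma conv_hull_sub S K : convex_set K -> S `<=` K -> @conv_hull R S `<=` K.
Proof. exact: smallest_sub. Qed.

Lemma convex_position_not_sub (G : set (set (plane R))) A : convex_position G ->
  G A -> ~ A `<=` conv_hull (\bigcup_(B in G `\ A) B).
Proof.
move=> cG GA sA; apply: (cG A GA); apply/seteqP; split; last first.
  apply: conv_hull_sub; first exact: conv_hull_convex.
  by apply: subset_trans (@sub_conv_hull _); apply: bigcup_subset => B [].
apply: conv_hull_sub; first exact: conv_hull_convex.
move=> x [B GB Bx]; have [BA|BA] := pselect (B = A); first by apply: sA; rewrite -BA.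
by apply: sub_conv_hull; exists B.
Qed.

(** An open half plane bounded by a line through [p] is convex and contains the other members, hence
    their hull, but not [p]. *)
Lemma convex_positionP (G : set (set (plane R))) :
  (forall A, G A -> exists u p, A p /\
     forall B x, G B -> B <> A -> B x -> dotp u x < dotp u p) ->
  convex_position G.
Proof.
move=> H A GA E; have [u [p [Ap up]]] := H A GA.
have hp : conv_hull (\bigcup_(B in G) B) p by apply: sub_conv_hull; exists A.
suff sub : conv_hull (\bigcup_(B in G `\ A) B) `<=` [set x | dotp u x < dotp u p].
  by rewrite E in hp; have := sub p hp; rewrite /= ltxx.
apply: conv_hull_sub; last by move=> x [B [GB BA] Bx]; exact: up GB BA Bx.
apply: convex_setP => x y a b /= ux uy a0 b0 ab.
rewrite dotpDr !dotpZr -[ltRHS]mul1r -ab mulrDl.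
have [aE | a_neq0] := eqVneq a 0.
  by move: ab; rewrite aE add0r => ->; lra.
apply: ltr_leD; last by rewrite ler_wpM2l // ltW.
by rewrite ltr_pM2l // lt_neqAle eq_sym a_neq0.
Qed.

(** A point of [A] outside the join is strictly separated from it; the angle of the normal is the
    direction sought. *)
Lemma separated_direction A B (C : set (plane R)) : compact A -> A !=set0 ->
    compact B -> convex_set B -> B !=set0 ->
    compact C -> convex_set C -> C !=set0 -> ~ A `<=` join_set B C ->
  exists t, supp B (dir t) < supp A (dir t) /\ supp C (dir t) < supp A (dir t).
Proof.
move=> kA A0 kB cB B0 kC cC C0 /existsNP[a /not_implyP[Aa Ka]].
have [[b Bb] [c Cc]] := (B0, C0).
have joinB x : B x -> join_set B C x.
  move=> Bx; exists (1, (x, c)); last by rewrite /= scale1r subrr scale0r addr0.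
  by split=> //=; rewrite in_itv /= lexx ler01.
have joinC x : C x -> join_set B C x.
  move=> Cx; exists (0, (b, x)); last by rewrite /= scale0r subr0 scale1r add0r.
  by split=> //=; rewrite in_itv /= lexx ler01.
have [w sep] : exists w, forall p q, [set a] p -> join_set B C q -> dotp w p < dotp w q.
  apply: strict_separation.
  - exact: compact_set1.
  - by apply: convex_setP => _ _ s t -> -> _ _ st; rewrite /= -scalerDl st scale1r.
  - by exists a.
  - exact: join_set_compact.
  - exact: join_set_convex.
  - by exists b; apply: joinB.
  - by apply/seteqP; split=> // x [/= ->].
have wlt x : join_set B C x -> dotp (- w) x < dotp (- w) a.
  by move=> /(sep a x erefl); rewrite -scaleN1r !dotpZl; lra.
have w0 : - w != 0.
  apply/eqP => w0; have := wlt b (joinB b Bb).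
  by rewrite w0 -(scale0r 0) !dotpZl !mul0r ltxx.
have [t [r [r0 wE]]] := dir_onto w0; exists t.
have {}wlt x : join_set B C x -> dotp (dir t) x < supp A (dir t).
  move=> /wlt; rewrite wE !dotpZl ltr_pM2l // => /lt_le_trans; apply.
  by have [_ [_ _]] := suppP (dir t) kA A0; apply.
by split; [have [p [Bp -> _]] := suppP (dir t) kB B0; apply/wlt/joinB |
           have [p [Cp -> _]] := suppP (dir t) kC C0; apply/wlt/joinC].
Qed.

Lemma join_set_sub B (C K : set (plane R)) :
  convex_set K -> B `<=` K -> C `<=` K -> join_set B C `<=` K.
Proof.
move=> cK BK CK _ [[s [p q]] /= [s01 [Bp Cq]] <-].
move: s01; rewrite in_itv /= => /andP[s0 s1].
apply: convex_comb => //; [exact: BK | exact: CK | by rewrite subr_ge0 |].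
by rewrite addrC subrK.
Qed.

End Plane.

(** * From families of convex bodies to curves and back *)

Local Open Scope card_scope.

Lemma image_seq_card (T : choiceType) (U : Type) (g : T -> U) (s : seq T) :
  injective g -> uniq s -> [set g i | i in [set` s]] #= `I_(size s).
Proof.
case: s => [|x0 s] gI us.
  rewrite [X in X #= _](_ : _ = set0) ?II0 ?card_eqxx //.
  by apply/seteqP; split=> // ? [].
have -> : [set g i | i in [set` x0 :: s]] =
    [set g (nth x0 (x0 :: s) k) | k in `I_(size (x0 :: s))].
  apply/seteqP; split=> _ [i /= si <-]; last first.
    by exists (nth x0 (x0 :: s) i); rewrite /= ?mem_nth.
  by exists (index i (x0 :: s)); rewrite ?nth_index // index_mem.
apply: inj_card_eq => k l; rewrite !inE => ks ls /gI/eqP.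
by rewrite nth_uniq // => /eqP.
Qed.

(** Disjointness gives [two_cross], the absence of common tangents [no_triple], and general position
    [visible3]. Conversely, a direction in which one curve is on top separates a point of its body
    from the other bodies. *)
Lemma convex_subfamily (R : realType) (n : nat) (F : set (set (plane R))) :
    (3 <= n)%N -> (forall A, F A -> convex_body A) -> pairwise_disjoint F ->
    general_position F -> no_three_common_tangent F ->
    `I_(('C(2 * n - 5, n - 2) + 1) * 'C(2 * n - 4, n - 2) + 1)%N #<= F ->
  exists G : set (set (plane R)), [/\ G `<=` F, G #= `I_n & convex_position G].
Proof.
move=> n3 bodyF disjF genF tanF.
set N := (_ * _ + 1)%N => /pcard_leP[h].
pose g (i : 'I_N) := h i.
have gF i : F (g i) by apply: (@funS _ _ `I_N F h); exact: ltn_ord.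
have gI : injective g.
  by move=> i j /(@inj _ _ `I_N h) ij; apply/val_inj/ij; rewrite inE /=; exact: ltn_ord.
have N3 : (3 <= N)%N.
  have : (0 < 'C(2 * n - 5, n - 2))%N by rewrite bin_gt0; lia.
  have : (0 < 'C(2 * n - 4, n - 2))%N by rewrite bin_gt0; lia.
  by rewrite /N; nia.
have kF i : compact (g i) by have [] := bodyF _ (gF i).
have cF i : convex_set (g i) by have [] := bodyF _ (gF i).
have triple i j k : i != j -> i != k -> j != k ->
    ~ g i `<=` conv_hull (\bigcup_(B in [set g x | x in [set` [:: i; j; k]]] `\ g i) B).
  move=> ij ik jk; apply: convex_position_not_sub; last first.
    by exists i => //=; rewrite mem_head.
  apply: genF; first by move=> _ [x _ <-].
  by apply: (@image_seq_card _ _ g [:: i; j; k]) => //=; rewrite !inE negb_or ij ik jk.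
have others (i : 'I_N) : exists j k, [/\ i != j, i != k & j != k].
  have : (1 < #|predC1 i|)%N by rewrite cardC1 card_ord; lia.
  move=> /card_gt1P[j [k [+ + jk]]]; rewrite !inE ![_ == i]eq_sym => ij ik.
  by exists j, k.
(* General position excludes empty members, since the empty set lies in every hull. *)
have g0 i : g i !=set0.
  have [j [k [ij ik jk]]] := others i.
  by apply/set0P/eqP => gi; apply: (triple i j k) => //; rewrite gi.
have gN i j : i != j -> g i <> g j by move=> ij /gI/eqP; rewrite (negPf ij).
pose f i t := supp (g i) (dir t).
have pi0 : 0 < 2 * pi :> R by have := pi_gt0 R; lra.
have [||||||s [szs us vs]] := @convex_subsystem R 'I_N f (2 * pi) pi0 _ _ _ _ _ n n3.
- by move=> i; apply: supp_continuous.
- by move=> i t; rewrite /f dirD2pi.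
- move=> i j a b c d ij ab bc cd da fa fb fc fd.
  have gij := disjF _ _ (gF i) (gF j) (gN i j ij).
  exact: (supp_two_cross (kF i) (cF i) (g0 i) (kF j) (cF j) (g0 j) gij
    ab bc cd da fa fb fc fd).
- move=> i j k t ij ik jk fij fik.
  apply: (tanF (g i) (g j) (g k)) => //; try exact: gN.
  (* The common support value is the offset of a line tangent to all three bodies. *)
  exists [set x | dotp (dir t) x = f i t].
  have tan l : f i t = f l t -> tangent_line [set x | dotp (dir t) x = f i t] (g l).
    move=> E; exists (dir t), (f i t); rewrite E.
    have [p [gp fp fmax]] := suppP (dir t) (kF l) (g0 l).
    by split; [exact: dir_neq0 | by [] | exact: fmax | exists p].
  by split; apply: tan.
- move=> i j k ij ik jk.
  apply: separated_direction => // sub; apply: (triple i j k) => //.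
  apply: subset_trans sub _; apply: join_set_sub; first exact: conv_hull_convex.
    apply: subset_trans (@sub_conv_hull _ _) => x gx; exists (g j) => //; split.
      by exists j => //=; rewrite !inE eqxx orbT.
    by apply: gN; rewrite eq_sym.
  apply: subset_trans (@sub_conv_hull _ _) => x gx; exists (g k) => //; split.
    by exists k => //=; rewrite !inE eqxx !orbT.
  by apply: gN; rewrite eq_sym.
- by rewrite card_ord.
exists [set g i | i in [set` s]]; split.
- by move=> _ [i _ <-].
- by rewrite -szs; apply: image_seq_card.
apply: convex_positionP => _ [i si <-].
have [t tP] := vs i si.
have [p [gp fp _]] := suppP (dir t) (kF i) (g0 i).
exists (dir t), p; split=> // _ x [j sj <-] gji gx.
have [_ [_ _ /(_ x gx) xle]] := suppP (dir t) (kF j) (g0 j).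
apply: le_lt_trans xle _; rewrite -fp; apply: tP => //.
by apply/eqP => ji; apply: gji; rewrite ji.
Qed.

Theorem theorem6 (R : realType) (n : nat) (n_ge3 : (3 <= n)%N) :
  (forall F : set (set (plane R)),
     (forall A, F A -> convex_body A) ->
     pairwise_disjoint F ->
     general_position F ->
     no_two_tangent F ->
     no_three_common_tangent F ->
     `I_(('C(2 * n - 5, n - 2) + 1) * 'C(2 * n - 4, n - 2) + 1)%N #<= F ->
     exists G : set (set (plane R)),
       [/\ G `<=` F, G #= `I_n & convex_position G])
  /\
  (exists m : nat, is_M R n m /\
     (m <= ('C(2 * n - 5, n - 2) + 1) * 'C(2 * n - 4, n - 2) + 1)%N).
Proof.
have forced : forces_convex_position R n
    (('C(2 * n - 5, n - 2) + 1) * 'C(2 * n - 4, n - 2) + 1)%N.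
  by move=> F [bodyF disjF genF _ tanF]; exact: convex_subfamily.
split; first by move=> F bodyF disjF genF _; exact: convex_subfamily.
have ex : exists m, `[< forces_convex_position R n m >].
  by eexists; apply/asboolP; exact: forced.
case: (ex_minnP ex) => m /asboolP fm mmin.
exists m; split; last by apply: mmin; apply/asboolP.
by split=> // k fk; apply: mmin; apply/asboolP.
Qed.
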